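(* Let $R$ be a left Zacharias domain which is a principal ideal domain, let $\mathsf R$ be a multivariate Ore extension of $R$ in which each $\alpha_i$ is an automorphism, let $F=\{g_1,\dots,g_u\}\subset\mathsf R^m\setminus\{0\}$ and $\mathsf M=\mathbb I_L(F)$. Then the following conditions are equivalent: (1) $F$ is a left (weak) Gröbner basis of $\mathsf M$; (2) a completion of $F$ is a left strong Gröbner basis of $\mathsf M$.
   Context: **Ore extensions.** $R$ is a (not necessarily commutative) domain with identity. A multivariate Ore extension $\mathsf R=R[Y_1;\alpha_1,\delta_1]\cdots[Y_n;\alpha_n,\delta_n]$ of $R$ is an iterated Ore extension ($Y_i\star r=\alpha_i(r)Y_i+\delta_i(r)$, $\alpha_i$ an injective ring endomorphism mapping $R$ to $R$, $\delta_i$ an $\alpha_i$-derivation mapping $R$ to $R$, i.e. additive with $\delta_i(rr')=\alpha_i(r)\delta_i(r')+\delta_i(r)r'$) such that $\alpha_j\delta_i=\delta_i\alpha_j$ for $i\ne j$, $\alpha_i\alpha_j=\alpha_j\alpha_i$, $\delta_i\delta_j=\delta_j\delta_i$, and $\alpha_j(Y_i)=Y_i$, $\delta_j(Y_i)=0$ for $i<j$. Its multiplication is $\star$. It is a free left $R$-module on the set of terms $\mathcal T=\{Y_1^{a_1}\cdots Y_n^{a_n}\}$, a commutative monoid. For $\tau=Y_1^{a_1}\cdots Y_n^{a_n}$ put $\alpha_\tau=\alpha_1^{a_1}\cdots\alpha_n^{a_n}:R\to R$. The associated graded Ore extension is the same left $R$-module with multiplication $\ast$ determined by $(a\tau)\ast(b\omega)=a\,\alpha_\tau(b)\,\tau\omega$.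 **Orderings.** $\mathsf R^m$ has canonical basis $\mathbf e_1,\dots,\mathbf e_m$ and terms $\mathcal T^{(m)}=\{t\mathbf e_i\}$. Fix a term ordering $\prec$ on $\mathcal T$ and a compatible term ordering $<$ on $\mathcal T^{(m)}$: a well-ordering with $\omega_1\prec\omega_2\Rightarrow\omega_1t<\omega_2t$ and $t_1<t_2\Rightarrow\omega t_1<\omega t_2$. $\mathbf T(f)$, $\mathrm{lc}(f)$, $\mathbf M(f)=\mathrm{lc}(f)\mathbf T(f)$ are the maximal term, leading coefficient and maximal monomial of $f$. **Gröbner notions.** $\mathbb I_L(F)$ is the left $\mathsf R$-module generated by $F$. $F$ is a left (weak) Gröbner basis of $\mathsf M=\mathbb I_L(F)$ if for every $f\in\mathsf M\setminus\{0\}$, $\mathbf M(f)=\sum_ia_i\lambda_i\ast\mathbf M(g_{j_i})$ with $a_i\in R\setminus\{0\}$, $\lambda_i\in\mathcal T$, $\lambda_i\mathbf T(g_{j_i})=\mathbf T(f)$. A set $G\subset\mathsf M$ is a left strong Gröbner basis of $\mathsf M$ if for every $f\in\mathsf M\setminus\{0\}$ there are $g\in G$, $a\in R\setminus\{0\}$, $\lambda\in\mathcal T$ with $\mathbf M(f)=a\lambda\ast\mathbf M(g)$. A left Gröbner representation of $f\neq0$ in terms of $F$ is $f=\sum_il_i\star g_i$ with $l_i\in\mathsf R$ and $\mathbf T(l_i)\mathbf T(g_i)\le\mathbf T(f)$ whenever $l_i\ne0$. **Completion.** Write $\mathbf M(g_i)=c_i\tau_i\mathbf e_{l_i}$. For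 a nonempty $H\subset\{1,\dots,u\}$ with $l_i$ constant on $H$ let $\varepsilon_H=\mathbf e_{l_i}$ ($i\in H$), $\tau_H=\mathrm{lcm}(\tau_i:i\in H)$, $\mathbf T(H)=\tau_H\varepsilon_H$, $\alpha_{H,i}=\alpha_{\tau_H/\tau_i}$. $H$ is maximal for $\mathbf T(H)$ if $H=\{i:1\le i\le u,\ \tau_i\mid\tau_H,\ \mathbf e_{l_i}=\varepsilon_H\}$. A set $C\subset\mathsf R^m$ is called a completion of $F$ if, for each such $H$ which is maximal for $\mathbf T(H)$, it contains an element $f_H\in\mathbb I_L(F)$ such that $\mathbf T(f_H)=\mathbf T(H)$, $\mathrm{lc}(f_H)=\gcd(\alpha_{H,i}(c_i):i\in H)$, and $f_H$ has a left Gröbner representation in terms of $F$. Here $\gcd$ is the greatest common divisor in $R$, i.e. a generator of the left ideal generated by the given elements. **Zacharias ring.** A ring $R$ with identity is a left Zacharias ring if it is noetherian, there is an algorithm deciding membership of $c\in R^m$ in the left module generated by a finite $\{c_1,\dots,c_t\}\subset R^m\setminus\{0\}$ and producing $d_i\in R$ with $c=\sum d_ic_i$ when it holds, and there is an algorithm computing a finite generating set of the left syzygy module of $c_1,\dots,c_t$.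
   Formalization: A completion is taken to consist only of elements f_H for maximal H; if further elements were allowed, as the definition literally permits, M itself or all of R^m would be a completion and the equivalence would fail. It is proved both for ''some'' and for ''every'' completion. *)

(* Defs.v *)
From HB Require Import structures.
From mathcomp Require Import all_boot all_order all_algebra.
From mathcomp Require Import ssrcomplements.
From mathcomp Require Export mpoly.

Set Implicit Arguments.
Unset Strict Implicit.
Unset Printing Implicit Defensive.

Import GRing.Theory.
Local Open Scope ring_scope.

(* The base ring R is not assumed commutative, so that MathComp's integral    *)
(* domains do not apply.  Only left ideals are constrained below; they are    *)
(* arbitrary, i.e. Prop-valued, sets.                                         *)

Definition is_domain (R : nzRingType) : Prop :=
  forall x y : R, x * y = 0 -> x = 0 \/ y = 0.

Definition left_ideal (R : nzRingType) (I : R -> Prop) : Prop :=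
  [/\ I 0, forall x y, I x -> I y -> I (x + y) & forall a x, I x -> I (a * x)].

Definition left_principal_ideal_ring (R : nzRingType) : Prop :=
  forall I : R -> Prop, left_ideal I ->
    exists d : R, forall x, I x <-> exists a, x = a * d.

Definition left_noetherian (R : nzRingType) : Prop :=
  forall I : nat -> R -> Prop, (forall k, left_ideal (I k)) ->
    (forall k x, I k x -> I k.+1 x) ->
    exists N, forall k, (N <= k)%N -> forall x, I k x <-> I N x.

(* The two algorithms are data, namely functions together with their          *)
(* specifications, as for the decision procedure of a decFieldType.  The      *)
(* elements c_1, ..., c_t of R^m are the rows of c, so that d *m c is the     *)
(* left linear combination \sum_i d_i c_i.                                    *)
Record left_zacharias (R : nzRingType) : Type := LeftZacharias {
  zach_noetherian : left_noetherian R;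
  zach_mem : forall m t : nat, 'M[R]_(t, m) -> 'rV[R]_m -> option 'rV[R]_t;
  zach_memP : forall m t (c : 'M[R]_(t, m)) (x : 'rV[R]_m),
    (forall i, row i c != 0) ->
    if zach_mem c x is Some d then x = d *m c
    else ~ exists d : 'rV[R]_t, x = d *m c;
  zach_syz : forall m t : nat, 'M[R]_(t, m) -> {s : nat & 'M[R]_(s, t)};
  zach_syzP : forall m t (c : 'M[R]_(t, m)) (d : 'rV[R]_t),
    (forall i, row i c != 0) ->
    d *m c = 0 <-> exists e, d = e *m projT2 (zach_syz c)
}.

(* The greatest common divisor, up to the choice of the generator. *)
Definition is_gcd (R : nzRingType) (I : finType) (H : {set I}) (x : I -> R)
    (d : R) : Prop :=
  forall y : R, (exists a : R, y = a * d) <->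
                (exists b : I -> R, y = \sum_(i in H) b i * x i).

(* The conditions alpha_j(Y_i) = Y_i and delta_j(Y_i) = 0 extend alpha_j and  *)
(* delta_j from R to R[Y_1; ...]...[Y_(j-1); ...], so the whole extension is  *)
(* determined by their restrictions to R.                                     *)
Record oreData (R : nzRingType) (n : nat) : Type := OreData {
  ore_alpha : 'I_n -> {rmorphism R -> R};
  ore_delta : 'I_n -> {additive R -> R};
  ore_alpha_inj : forall i, injective (ore_alpha i);
  ore_deltaM : forall i x y, ore_delta i (x * y) =
     ore_alpha i x * ore_delta i y + ore_delta i x * y;
  ore_alpha_alpha : forall i j x,
     ore_alpha i (ore_alpha j x) = ore_alpha j (ore_alpha i x);
  ore_delta_delta : forall i j x,
     ore_delta i (ore_delta j x) = ore_delta j (ore_delta i x);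
  ore_alpha_delta : forall i j x, i != j ->
     ore_alpha j (ore_delta i x) = ore_delta i (ore_alpha j x)
}.

(* The carrier is the free left R-module on the terms: an element is          *)
(* identified with the family of its left coefficients, f = \sum_t f@_t Y^t,  *)
(* and 'X_[t] stands for the term Y^t.  The parameter D only selects the      *)
(* product, which is ore_mul below and not that of {mpoly R[n]}.              *)
Definition oreExt (R : nzRingType) (n : nat) (D : oreData R n) : Type :=
  {mpoly R[n]}.
HB.instance Definition _ R n (D : oreData R n) := GRing.Zmodule.on (oreExt D).

Section OreExtension.
Context (R : nzRingType) (n : nat) (D : oreData R n).
Local Notation S := (oreExt D).


Implicit Types (i j : 'I_n) (s t : 'X_{1..n}) (p q : {mpoly R[n]}).

Definition ext_alpha i : {mpoly R[n]} -> {mpoly R[n]} :=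
  map_mpoly (ore_alpha D i).
Definition ext_delta i : {mpoly R[n]} -> {mpoly R[n]} :=
  map_mpoly (ore_delta D i).

(* Y_i * (b Y^t) = alpha_i(b) Y_i Y^t + delta_i(b) Y^t. *)
Definition ystar i p : {mpoly R[n]} := 'X_i * ext_alpha i p + ext_delta i p.

(* (Y_1^(t_1) ... Y_n^(t_n)) * p. *)
Definition tstar t p : {mpoly R[n]} :=
  foldr (fun i q => iter (t i) (ystar i) q) p (enum 'I_n).

Definition ore_mul p q : {mpoly R[n]} := \sum_(t <- msupp p) p@_t *: tstar t q.

Lemma ext_alphaZ i (a : R) p : ext_alpha i (a *: p) = ore_alpha D i a *: ext_alpha i p.
Proof.
by apply/mpolyP => t; rewrite mcoeff_map_mpoly !mcoeffZ mcoeff_map_mpoly /= rmorphM.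
Qed.

Lemma ext_deltaZ i (a : R) p : ext_delta i (a *: p) =
  ore_alpha D i a *: ext_delta i p + ore_delta D i a *: p.
Proof.
by apply/mpolyP => t;
  rewrite mcoeffD mcoeff_map_mpoly !mcoeffZ mcoeff_map_mpoly /= ore_deltaM.
Qed.

Lemma ext_alphaD i : {morph ext_alpha i : p q / p + q}.
Proof. by move=> p q; rewrite /ext_alpha raddfD. Qed.

Lemma ext_deltaD i : {morph ext_delta i : p q / p + q}.
Proof. by move=> p q; rewrite /ext_delta raddfD. Qed.

Lemma ext_alpha0 i : ext_alpha i 0 = 0.
Proof. by rewrite /ext_alpha raddf0. Qed.

Lemma ext_delta0 i : ext_delta i 0 = 0.
Proof. by rewrite /ext_delta raddf0. Qed.

Lemma ore_delta1 i : ore_delta D i 1 = 0.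
Proof.
have := ore_deltaM D i 1 1; rewrite !mulr1 rmorph1 mul1r => /eqP.
by rewrite -subr_eq0 opprD addrA subrr sub0r oppr_eq0 => /eqP.
Qed.

Lemma ext_alphaX i t : ext_alpha i 'X_[t] = 'X_[t].
Proof.
by apply/mpolyP=> s; rewrite mcoeff_map_mpoly mcoeffX /= rmorph_nat.
Qed.

Lemma ext_deltaX i t : ext_delta i 'X_[t] = 0.
Proof.
apply/mpolyP=> s; rewrite mcoeff_map_mpoly mcoeffX mcoeff0.
by case: (t == s); rewrite ?ore_delta1 ?raddf0.
Qed.

Lemma XjC j p : 'X_j * p = p * 'X_j.
Proof. by apply: commr_sym; apply: commr_mpolyX. Qed.

Lemma map_mpolyXM (f : {additive R -> R}) j p :
  map_mpoly f ('X_j * p) = 'X_j * map_mpoly f p.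
Proof.
have fZX a t : map_mpoly f (a *: 'X_[t]) = f a *: 'X_[t].
  apply/mpolyP => s; rewrite mcoeff_map_mpoly !mcoeffZ !mcoeffX.
  by case: (t == s); rewrite ?mulr1 ?mulr0 ?raddf0.
rewrite !XjC; elim/mpolyind: p => [|a t p _ _ IH].
  by rewrite mul0r raddf0 mul0r.
by rewrite mulrDl !raddfD /= mulrDl IH -scalerAl -mpolyXD !fZX -scalerAl mpolyXD.
Qed.

Lemma ext_alphaXM i j p : ext_alpha i ('X_j * p) = 'X_j * ext_alpha i p.
Proof. exact: map_mpolyXM. Qed.

Lemma ext_deltaXM i j p : ext_delta i ('X_j * p) = 'X_j * ext_delta i p.
Proof. exact: map_mpolyXM. Qed.

Lemma ystarD i : {morph ystar i : p q / p + q}.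
Proof.
by move=> p q; rewrite /ystar ext_alphaD ext_deltaD mulrDr addrACA.
Qed.

Lemma ystar0 i : ystar i 0 = 0.
Proof. by rewrite /ystar ext_alpha0 ext_delta0 mulr0 addr0. Qed.

Lemma scalerXr i (a : R) p : 'X_i * (a *: p) = a *: ('X_i * p).
Proof. by rewrite !XjC scalerAl. Qed.

Lemma ystarZ i a p :
  ystar i (a *: p) = ore_alpha D i a *: ystar i p + ore_delta D i a *: p.
Proof. by rewrite /ystar ext_alphaZ ext_deltaZ scalerXr scalerDr addrA. Qed.

Lemma ystarX i t : ystar i 'X_[t] = 'X_[U_(i) + t].
Proof. by rewrite /ystar ext_alphaX ext_deltaX addr0 mpolyXD. Qed.

Lemma ext_alphaA i j p : ext_alpha i (ext_alpha j p) = ext_alpha j (ext_alpha i p).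
Proof. by apply/mpolyP=> t; rewrite !mcoeff_map_mpoly /= ore_alpha_alpha. Qed.

Lemma ext_deltaA i j p : ext_delta i (ext_delta j p) = ext_delta j (ext_delta i p).
Proof. by apply/mpolyP=> t; rewrite !mcoeff_map_mpoly /= ore_delta_delta. Qed.

Lemma ext_alpha_delta i j p : i != j ->
  ext_alpha j (ext_delta i p) = ext_delta i (ext_alpha j p).
Proof.
by move=> ij; apply/mpolyP=> t; rewrite !mcoeff_map_mpoly /= ore_alpha_delta.
Qed.

Lemma ext_alpha_ystar i j p : i != j ->
  ext_alpha j (ystar i p) = ystar i (ext_alpha j p).
Proof.
by move=> ij; rewrite /ystar ext_alphaD ext_alphaXM ext_alphaA ext_alpha_delta.
Qed.

Lemma ext_delta_ystar i j p : i != j ->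
  ext_delta j (ystar i p) = ystar i (ext_delta j p).
Proof.
move=> ij; have ji : j != i by rewrite eq_sym.
by rewrite /ystar ext_deltaD ext_deltaXM ext_deltaA ext_alpha_delta.
Qed.

Lemma ystarC i j p : ystar i (ystar j p) = ystar j (ystar i p).
Proof.
have [->//|ij] := eqVneq i j; have ji : j != i by rewrite eq_sym.
rewrite [LHS]/ystar ext_alphaD ext_deltaD ext_alphaXM ext_deltaXM.
rewrite [RHS]/ystar ext_alphaD ext_deltaD ext_alphaXM ext_deltaXM /ystar.
rewrite !mulrDr -!addrA; congr (_ + _).
  by rewrite !mulrA (XjC i 'X_j) ext_alphaA.
by rewrite addrCA ext_deltaA !ext_alpha_delta.
Qed.

Lemma iter_ystarC k l i j p : iter k (ystar i) (iter l (ystar j) p) =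
  iter l (ystar j) (iter k (ystar i) p).
Proof.
have H q : ystar i (iter l (ystar j) q) = iter l (ystar j) (ystar i q).
  by elim: l q => //= l IH q; rewrite ystarC IH.
by elim: k => //= k ->; rewrite H.
Qed.

Lemma tstarD t : {morph tstar t : p q / p + q}.
Proof.
move=> p q; rewrite /tstar; elim: (enum _) => //= i r ->.
by elim: (t i) => //= k ->; rewrite ystarD.
Qed.

Lemma tstar0 t : tstar t 0 = 0.
Proof.
rewrite /tstar; elim: (enum _) => //= i r ->.
by elim: (t i) => //= k ->; rewrite ystar0.
Qed.

Lemma tstar_ystar i t p : tstar (U_(i) + t)%MM p = ystar i (tstar t p).
Proof.
have [] : (i \in enum 'I_n) /\ uniq (enum 'I_n) by rewrite mem_enum enum_uniq.
rewrite /tstar; elim: (enum _) => //= j r IH.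
rewrite inE => + /andP[jr ur]; have [ij|ij] := eqVneq i j.
  move=> _; subst j; rewrite mnmDE mnm1E eqxx add1n /=; congr (ystar i (iter _ _ _)).
  elim: r jr {ur IH} => //= j r IH; rewrite inE negb_or => /andP[ij jr].
  by rewrite IH // mnmDE mnm1E (negPf ij) add0n.
move=> /= ir; rewrite IH // mnmDE mnm1E (negPf ij) add0n.
by rewrite -(iter_ystarC 1).
Qed.

Lemma tstarX0 p : tstar 0%MM p = p.
Proof. by rewrite /tstar; elim: (enum _) => //= i r ->; rewrite mnm0E. Qed.

Lemma mnm_ind (P : 'X_{1..n} -> Prop) : P 0%MM ->
  (forall i t, P t -> P (U_(i) + t)%MM) -> forall t, P t.
Proof.
move=> P0 PS t; have [k] := ubnP (mdeg t); elim: k t => // k IH t tk.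
have [->//|] := eqVneq t 0%MM; rewrite -mdeg_eq0 mdegE.
rewrite sum_nat_eq0 => /forallPn[i ti].
have le : (U_(i) <= t)%MM by rewrite lep1mP.
rewrite -(submK le) addmC; apply/PS/IH.
by move: tk; rewrite -{1}(submK le) mdegD mdeg1 addn1 ltnS.
Qed.

Lemma tstarXX t : tstar t 1 = 'X_[t].
Proof.
elim/mnm_ind: t => [|i t IH]; first by rewrite tstarX0 mpolyX0.
by rewrite tstar_ystar IH ystarX.
Qed.

Lemma ore_mulE k p q : (msize p <= k)%N ->
  ore_mul p q = \sum_(t : 'X_{1..n < k}) p@_t *: tstar t q.
Proof.
move=> lek; rewrite /ore_mul.
rewrite (big_mksub 'X_{1..n < k}) ?msupp_uniq //=; first last.
  by move=> t /msize_mdeg_lt /leq_trans; apply.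
by rewrite big_rmcond //= => j /memN_msupp_eq0 ->; rewrite scale0r.
Qed.

Lemma ore_mulDl : left_distributive ore_mul +%R.
Proof.
move=> p q r; pose k := maxn (msize (p + q)) (maxn (msize p) (msize q)).
rewrite !(@ore_mulE k) ?leq_max ?leqnn ?orbT // -big_split /=.
by apply: eq_bigr => t _; rewrite mcoeffD scalerDl.
Qed.

Lemma ore_mulDr : right_distributive ore_mul +%R.
Proof.
move=> p q r; rewrite /ore_mul -big_split /=.
by apply: eq_bigr => t _; rewrite tstarD scalerDr.
Qed.

Lemma ore_mul0l : left_zero 0 ore_mul.
Proof. by move=> p; rewrite /ore_mul msupp0 big_nil. Qed.

Lemma ore_mulZl (a : R) p q : ore_mul (a *: p) q = a *: ore_mul p q.
Proof.
pose k := maxn (msize (a *: p)) (msize p).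
rewrite !(@ore_mulE k) ?leq_max ?leqnn ?orbT // scaler_sumr.
by apply: eq_bigr => t _; rewrite mcoeffZ scalerA.
Qed.

Lemma ore_mulX t q : ore_mul 'X_[t] q = tstar t q.
Proof. by rewrite /ore_mul msuppX big_seq1 mcoeffX eqxx scale1r. Qed.

Lemma ore_mul_ystar i p q : ore_mul (ystar i p) q = ystar i (ore_mul p q).
Proof.
elim/mpolyind: p => [|a t p _ _ IH]; first by rewrite ystar0 !ore_mul0l ystar0.
rewrite ystarD ore_mulDl IH [ore_mul (_ + p) q]ore_mulDl ystarD; congr (_ + _).
by rewrite !ystarZ ore_mulDl !ore_mulZl ystarX !ore_mulX tstar_ystar ystarZ.
Qed.

Lemma ore_mul_tstar t p q : ore_mul (tstar t p) q = tstar t (ore_mul p q).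
Proof.
elim/mnm_ind: t => [|i t IH]; first by rewrite !tstarX0.
by rewrite !tstar_ystar ore_mul_ystar IH.
Qed.

Lemma ore_mulA : associative ore_mul.
Proof.
move=> p q r; elim/mpolyind: p => [|a t p _ _ IH]; first by rewrite !ore_mul0l.
by rewrite !ore_mulDl IH !ore_mulZl !ore_mulX ore_mul_tstar.
Qed.

Lemma ore_mul1l : left_id 1 ore_mul.
Proof. by move=> p; rewrite -mpolyX0 ore_mulX tstarX0. Qed.

Lemma ore_mul1r : right_id 1 ore_mul.
Proof.
move=> p; rewrite /ore_mul [RHS]mpolyE.
by apply: eq_bigr => t _; rewrite tstarXX.
Qed.

HB.instance Definition _ := GRing.Zmodule_isNzRing.Build S
  ore_mulA ore_mul1l ore_mul1r ore_mulDl ore_mulDr (oner_neq0 {mpoly R[n]}).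

Definition oreC (a : R) : S := a%:MP.
Definition oreY i : S := 'X_i.

(* The next lemmas identify S with the iterated Ore extension: the       *)
(* subset ore_stage j of the polynomials in the Y_i, i < j, is stable under   *)
(* the extensions of alpha_j and delta_j, on which they are a ring            *)
(* endomorphism and a twisted derivation, and Y_j commutes with it as in a    *)
(* univariate Ore extension.                                                  *)
Lemma oreY_oreC i a :
  oreY i * oreC a = oreC (ore_alpha D i a) * oreY i + oreC (ore_delta D i a).
Proof.
rewrite /GRing.mul /= /oreC /oreY !ore_mulX.
have E (b : R) : b%:MP = b *: 'X_[0] :> {mpoly R[n]}.
  by rewrite mpolyX0 -mul_mpolyC mulr1.
rewrite !E -[U_(i)%MM]addm0 tstar_ystar tstarX0 ystarZ ystarX.
by rewrite ore_mulZl ore_mulX tstarX0.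
Qed.

Lemma oreYC i j : oreY i * oreY j = oreY j * oreY i.
Proof.
rewrite /GRing.mul /= /oreY !ore_mulX.
rewrite -[U_(i)%MM]addm0 -[U_(j)%MM]addm0 !tstar_ystar !tstarX0 !ystarX.
by rewrite !addm0 addmC.
Qed.

Lemma oreC_mul a (f : S) : oreC a * f = a *: (f : {mpoly R[n]}).
Proof.
have -> : oreC a = a *: 'X_[0] :> {mpoly R[n]}.
  by rewrite mpolyX0 -mul_mpolyC mulr1.
by rewrite [LHS]ore_mulZl ore_mulX tstarX0.
Qed.

Lemma oreY_mul i (f : S) : oreY i * f = ystar i f.
Proof. by rewrite [LHS]ore_mulX -[U_(i)%MM]addm0 tstar_ystar tstarX0. Qed.

Lemma ore_term t : \prod_(i < n) oreY i ^+ t i = 'X_[t].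
Proof.
rewrite -tstarXX /tstar [index_enum _]unlock -enumT.
elim: (enum _) => [|i r IH]; first by rewrite big_nil.
rewrite big_cons {}IH /=; move: (foldr _ _ _) => q.
elim: (t i) => [|k IH]; first by rewrite expr0 mul1r.
by rewrite exprS -mulrA IH oreY_mul.
Qed.

Lemma ore_expand (f : S) :
  f = \sum_(t <- msupp f) oreC f@_t * \prod_(i < n) oreY i ^+ t i.
Proof.
rewrite [LHS]mpolyE; apply: eq_bigr => t _.
by rewrite ore_term oreC_mul.
Qed.

Definition ore_stage j (p : S) : Prop :=
  forall t i, t \in msupp p -> (j <= i)%N -> t i = 0%N.

Lemma ore_mul_map (f : {additive R -> R}) p q :
  ore_mul (map_mpoly f p) q = \sum_(t <- msupp p) f p@_t *: tstar t q.
Proof.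
pose k := maxn (msize (map_mpoly f p)) (msize p).
rewrite (@ore_mulE k) ?leq_max ?leqnn ?orbT //.
rewrite (big_mksub 'X_{1..n < k}) ?msupp_uniq //=; first last.
  by move=> t /msize_mdeg_lt /leq_trans; apply; rewrite leq_max leqnn orbT.
rewrite [RHS]big_rmcond //=; first by apply: eq_bigr => t _; rewrite mcoeff_map_mpoly.
by move=> t /memN_msupp_eq0 ->; rewrite raddf0 scale0r.
Qed.

Lemma ext_alpha_tstar j t q : t j = 0%N ->
  ext_alpha j (tstar t q) = tstar t (ext_alpha j q).
Proof.
move=> tj; rewrite /tstar; elim: (enum _) => //= i r <-.
have [->|ij] := eqVneq i j; first by rewrite tj.
by elim: (t i) => //= k <-; rewrite ext_alpha_ystar.
Qed.

Lemma ext_delta_tstar j t q : t j = 0%N ->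
  ext_delta j (tstar t q) = tstar t (ext_delta j q).
Proof.
move=> tj; rewrite /tstar; elim: (enum _) => //= i r <-.
have [->|ij] := eqVneq i j; first by rewrite tj.
by elim: (t i) => //= k <-; rewrite ext_delta_ystar.
Qed.

Lemma ext_alphaM j (p q : S) : ore_stage j p ->
  ext_alpha j (p * q) = (ext_alpha j p : S) * (ext_alpha j q : S).
Proof.
move=> pj; rewrite [RHS]ore_mul_map [p * q]/(ore_mul p q) /ore_mul.
rewrite /ext_alpha raddf_sum /=; apply: eq_big_seq => t /pj/(_ (leqnn j)) tj.
by rewrite -!/(ext_alpha j _) ext_alphaZ ext_alpha_tstar.
Qed.

Lemma ext_deltaM j (p q : S) : ore_stage j p ->
  ext_delta j (p * q) =
  (ext_alpha j p : S) * (ext_delta j q : S) +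
  (ext_delta j p : S) * q.
Proof.
move=> pj; rewrite [X in _ = X + _]ore_mul_map [X in _ = _ + X]ore_mul_map.
rewrite -big_split [p * q]/(ore_mul p q) /ore_mul.
rewrite /ext_delta raddf_sum /=; apply: eq_big_seq => t /pj/(_ (leqnn j)) tj.
by rewrite -!/(ext_delta j _) ext_deltaZ ext_delta_tstar.
Qed.

Lemma ext_alphaY i j : ext_alpha j (oreY i) = oreY i.
Proof. exact: ext_alphaX. Qed.

Lemma ext_deltaY i j : ext_delta j (oreY i) = 0.
Proof. exact: ext_deltaX. Qed.

Lemma oreY_stage j (p : S) :
  oreY j * p = (ext_alpha j p : S) * oreY j + (ext_delta j p : S).
Proof.
rewrite oreY_mul /ystar; congr (_ + _); rewrite XjC.
rewrite [RHS]/(ore_mul _ _) /ore_mul {1}[ext_alpha j p]mpolyE mulr_suml.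
apply: eq_bigr => t _; rewrite -scalerAl -mpolyXD; congr (_ *: _).
elim/mnm_ind: t => [|i t IH]; first by rewrite add0m tstarX0.
by rewrite tstar_ystar -IH ystarX addmA.
Qed.

End OreExtension.

(* Term orderings, given by their strict parts.                               *)

Definition well_ordering (T : eqType) (lt : rel T) : Prop :=
  [/\ irreflexive lt, transitive lt,
      forall x y, x != y -> lt x y || lt y x & well_founded lt].

Definition vterm (n m : nat) : Type := ('X_{1..n} * 'I_m)%type.
HB.instance Definition _ n m := Equality.on (vterm n m).

(* The module term w (t e_i). *)
Definition smul n m (w : 'X_{1..n}) (t : vterm n m) : vterm n m :=
  ((w + t.1)%MM, t.2).

Definition term_ordering n (prec : rel 'X_{1..n}) : Prop :=
  well_ordering prec /\
  forall w t1 t2, prec t1 t2 -> prec (w + t1)%MM (w + t2)%MM.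

Definition compatible_term_ordering n m (prec : rel 'X_{1..n})
    (lt : rel (vterm n m)) : Prop :=
  [/\ well_ordering lt,
      forall w1 w2 t, prec w1 w2 -> lt (smul w1 t) (smul w2 t) &
      forall w t1 t2, lt t1 t2 -> lt (smul w t1) (smul w t2)].

(* The maximum of a list, x0 being only the value at the empty list. *)
Definition max_of (T : Type) (lt : rel T) (x0 : T) (s : seq T) : T :=
  if s is x :: s' then foldr (fun y z => if lt z y then y else z) x s' else x0.

Section Groebner.
Context (R : nzRingType) (n : nat) (D : oreData R n).
Context (prec : rel 'X_{1..n}) (m : nat) (lt : rel (vterm n m.+1)).

(* The free module R^m has positive rank m.+1, so that the leading term of 0  *)
(* can be given a dummy value.  Its left module structure, *:, is given by    *)
(* the product of oreExt D.                                                   *)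
Local Notation S := (oreExt D).
Local Notation V := ('rV[oreExt D]_m.+1).
Local Notation term := (vterm n m.+1).

(* alpha_1^(t_1) o ... o alpha_n^(t_n). *)
Definition alpha_term (t : 'X_{1..n}) (a : R) : R :=
  foldr (fun i => iter (t i) (ore_alpha D i)) a (enum 'I_n).

(* The product of the associated graded Ore extension, and its action on the  *)
(* free module.                                                               *)
Definition gr_mul (f g : S) : S :=
  \sum_(s <- msupp f) \sum_(t <- msupp g)
     (f@_s * alpha_term s g@_t) *: ('X_[s + t] : {mpoly R[n]}).

Definition gr_act (f : S) (v : V) : V := \row_i gr_mul f (v 0 i).

Definition ore_monomial (a : R) (t : 'X_{1..n}) : S :=
  a *: ('X_[t] : {mpoly R[n]}).

Definition vmonomial (a : R) (t : term) : V :=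
  \row_i (if i == t.2 then ore_monomial a t.1 else 0).

Definition vsupp (f : V) : seq term :=
  [seq (t, i) | i <- enum 'I_m.+1, t <- msupp (f 0 i)].

Definition ore_lterm (f : S) : 'X_{1..n} := max_of prec 0%MM (msupp f).

Definition lterm (f : V) : term := max_of lt (0%MM, ord0) (vsupp f).

Definition lcoef (f : V) : R := (f 0 (lterm f).2)@_(lterm f).1.

Definition lmonomial (f : V) : V := vmonomial (lcoef f) (lterm f).

Definition term_le (s t : term) : bool := (s == t) || lt s t.

Section Basis.
Context (u : nat) (g : 'I_u -> V).

Definition left_span (f : V) : Prop :=
  exists l : 'I_u -> S, f = \sum_i l i *: g i.

Definition weak_groebner_basis : Prop :=
  forall f, left_span f -> f != 0 ->
  exists (k : nat) (a : 'I_k -> R) (w : 'I_k -> 'X_{1..n}) (j : 'I_k -> 'I_u),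
    (forall i, a i != 0 /\ smul (w i) (lterm (g (j i))) = lterm f) /\
    lmonomial f =
      \sum_i gr_act (ore_monomial (a i) (w i)) (lmonomial (g (j i))).

Definition groebner_representation (f : V) : Prop :=
  f != 0 /\ exists l : 'I_u -> S, f = \sum_i l i *: g i /\
    forall i, l i != 0 ->
      term_le (smul (ore_lterm (l i)) (lterm (g i))) (lterm f).

(* tau_H *)
Definition lcm_term (H : {set 'I_u}) : 'X_{1..n} :=
  \big[@mlcm n/0%MM]_(i in H) (lterm (g i)).1.

(* alpha_(H,i) *)
Definition alpha_set (H : {set 'I_u}) (i : 'I_u) : R -> R :=
  alpha_term (lcm_term H - (lterm (g i)).1)%MM.

(* H is nonempty, all the T(g_i), i in H, lie on the basis vector e, and H is *)
(* maximal for T(H) = (lcm_term H) e.                                         *)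
Definition maximal_set (H : {set 'I_u}) (e : 'I_m.+1) : Prop :=
  [/\ H != set0, forall i, i \in H -> (lterm (g i)).2 = e &
      H = [set i | ((lterm (g i)).1 <= lcm_term H)%MM
                   && ((lterm (g i)).2 == e)]].

Definition completion_element (H : {set 'I_u}) (e : 'I_m.+1) (f : V) : Prop :=
  [/\ left_span f, lterm f = (lcm_term H, e),
      is_gcd H (fun i => alpha_set H i (lcoef (g i))) (lcoef f) &
      groebner_representation f].

(* A completion contains an f_H for every maximal H, and nothing else. *)
Definition completion (C : V -> Prop) : Prop :=
  (forall H e, maximal_set H e -> exists2 f, C f & completion_element H e f) /\
  (forall f, C f -> exists H e, maximal_set H e /\ completion_element H e f).

End Basis.

Definition strong_groebner_basis (M G : V -> Prop) : Prop :=
  (forall f, G f -> M f) /\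
  forall f, M f -> f != 0 ->
    exists (h : V) (a : R) (w : 'X_{1..n}),
      [/\ G h, a != 0 &
          lmonomial f = gr_act (ore_monomial a w) (lmonomial h)].

End Groebner.

(* Main.v *)
Require Import Defs.
From mathcomp Require Import all_boot all_order all_algebra.
From mathcomp Require Import mpoly.

Set Implicit Arguments.
Unset Strict Implicit.
Unset Printing Implicit Defensive.

Import GRing.Theory.
Local Open Scope ring_scope.

(* A term w acts triangularly: T(w * f) = w T(f), with leading coefficient    *)
(* alpha_w(lc(f)), since Y_i b = alpha_i(b) Y_i + delta_i(b) and t < Y_i t.   *)
(* Hence, for a maximal H and d = sum_i b_i alpha_(H,i)(c_i) a generator of   *)
(* the left ideal of the alpha_(H,i)(c_i), the combination                    *)
(* sum_i b_i (tau_H/tau_i) * g_i may serve as f_H: completions exist.         *)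
(* If F is a weak basis and T(f) = t e, the set H of all i such that T(g_i)   *)
(* divides t e is maximal, and alpha_(t/tau_i)(c_i) =                         *)
(* alpha_(t/tau_H)(alpha_(H,i)(c_i)) is a left multiple of                    *)
(* alpha_(t/tau_H)(lc(f_H)); so lc(f) is one as well, and M(f) is a multiple  *)
(* of M(f_H). Conversely lc(f_H) is a combination of the alpha_(H,i)(c_i), so *)
(* any multiple of M(f_H) is a combination of multiples of the M(g_i).        *)

(** The equivalence is a statement about left ideals of leading coefficients over a fixed term. By
    [tstar_lead], multiplying by a term acts on leading data as the graded product does, so
    [completion_element_exists] can realise each gcd as a leading coefficient. [weak_strong] and
    [strong_weak] then translate between combinations of the [alpha_set] images and multiples of
    their gcd. As completions exist, it does not matter whether condition (2) speaks of some
    completion or of every one. *)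

Lemma max_of_mem (T : eqType) (r : rel T) x0 x (s : seq T) :
  transitive r -> (forall x y, x != y -> r x y || r y x) -> x \in s ->
  max_of r x0 s \in s /\ forall y, y \in s -> (y == max_of r x0 s) || r y (max_of r x0 s).
Proof.
move=> r_tr r_tot; case: s => // a s _ /=; elim: s => [|b s [mem_s max_s]] /=.
  by rewrite mem_head; split=> // y; rewrite inE => ->.
set z := foldr _ _ _ in mem_s max_s *.
case: ifPn => [zb|zb].
  split; first by rewrite !inE eqxx orbT.
  move=> y; rewrite !inE orbCA => /orP[->//|]; rewrite -in_cons => /max_s.
  by move=> /predU1P[->|yz]; rewrite ?zb ?(r_tr _ _ _ yz zb) orbT.
split; first by move: mem_s; rewrite !inE => /orP[]->; rewrite ?orbT.
move=> y; rewrite !inE orbCA => /orP[/eqP->|]; last by rewrite -in_cons => /max_s.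
by have [//|/r_tot] := eqVneq b z; rewrite (negPf zb) orbF.
Qed.

Section Groebner.
Context (R : nzRingType) (n : nat) (D : oreData R n).

(** * The endomorphisms of [R] attached to terms *)

Lemma alpha_term0 a : alpha_term D 0%MM a = a.
Proof. by rewrite /alpha_term; elim: (enum _) => //= i r ->; rewrite mnm0E. Qed.

Lemma iter_ore_alphaC k l i j a :
  iter k (ore_alpha D i) (iter l (ore_alpha D j) a) =
  iter l (ore_alpha D j) (iter k (ore_alpha D i) a).
Proof.
have H b : ore_alpha D i (iter l (ore_alpha D j) b) =
           iter l (ore_alpha D j) (ore_alpha D i b).
  by elim: l => //= l IH; rewrite ore_alpha_alpha IH.
by elim: k => //= k ->; rewrite H.
Qed.

Lemma alpha_termD s t a :
  alpha_term D (s + t)%MM a = alpha_term D s (alpha_term D t a).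
Proof.
rewrite /alpha_term; elim: (enum _) => //= i r ->.
rewrite mnmDE iterD; congr (iter _ _ _).
by move: (foldr _ a r) => b; elim: r => //= j r <-; rewrite iter_ore_alphaC.
Qed.

Lemma alpha_termU i a : alpha_term D U_(i)%MM a = ore_alpha D i a.
Proof.
rewrite /alpha_term; have: i \in enum 'I_n by rewrite mem_enum.
elim: (enum _) (enum_uniq 'I_n) => //= j r IH /andP[jr ur].
rewrite inE mnm1E; have [-> _|ij /= /IH->//] := eqVneq i j.
rewrite /=; congr (ore_alpha D j _).
elim: r jr {ur IH} => //= k r IH; rewrite inE negb_or => /andP[ij jr].
by rewrite mnm1E (negPf ij) /= IH.
Qed.

Lemma alpha_term_additive t :
  {morph alpha_term D t : a b / a + b} * (alpha_term D t 0 = 0).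
Proof.
elim/mnm_ind: t => [|i t IH]; split=> [a b|]; rewrite ?alpha_term0 //.
  by rewrite !alpha_termD !alpha_termU IH raddfD.
by rewrite alpha_termD alpha_termU IH raddf0.
Qed.

Lemma alpha_term_sum t (I : Type) r (P : pred I) F :
  alpha_term D t (\sum_(i <- r | P i) F i) =
  \sum_(i <- r | P i) alpha_term D t (F i).
Proof. by apply: big_morph; case: (alpha_term_additive t). Qed.

Lemma alpha_termM t : {morph alpha_term D t : a b / a * b}.
Proof.
elim/mnm_ind: t => [|i t IH] a b; first by rewrite !alpha_term0.
by rewrite !alpha_termD !alpha_termU IH rmorphM.
Qed.

Lemma alpha_term_eq0 t a : (alpha_term D t a == 0) = (a == 0).
Proof.
elim/mnm_ind: t => [|i t IH]; first by rewrite alpha_term0.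
rewrite alpha_termD alpha_termU -IH -[RHS](inj_eq (@ore_alpha_inj _ _ D i)).
by rewrite raddf0.
Qed.

Lemma ystar_coef i (p : {mpoly R[n]}) s :
  (ystar D i p)@_(U_(i) + s) = ore_alpha D i p@_s + ore_delta D i p@_(U_(i) + s).
Proof. by rewrite /ystar XjC mcoeffD mcoeffMX !mcoeff_map_mpoly. Qed.

(** The [delta] part leaves terms in place and the [alpha] part shifts them by [Y_i]. *)
Lemma ystar_supp i (p : {mpoly R[n]}) s :
  (ystar D i p)@_s != 0 ->
  p@_s != 0 \/ exists2 r, s = (U_(i) + r)%MM & p@_r != 0.
Proof.
rewrite /ystar XjC mcoeffD => nz.
have [p0|] := eqVneq p@_s 0; last by left.
right; move: nz; rewrite [X in _ + X]mcoeff_map_mpoly p0 /= raddf0 addr0.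
rewrite -mcoeff_msupp (perm_mem (msuppMX _ _)) => /mapP[r r_supp ->].
exists r => //; apply: contraTneq r_supp => r0.
by rewrite mcoeff_msupp mcoeff_map_mpoly /= r0 raddf0 eqxx.
Qed.

Context (prec : rel 'X_{1..n}) (m : nat) (lt : rel (vterm n m.+1)).
Context (prec_ord : term_ordering prec).
Context (lt_ord : compatible_term_ordering prec lt).

Local Notation S := (oreExt D).
Local Notation V := ('rV[oreExt D]_m.+1).
Local Notation term := (vterm n m.+1).

Implicit Types (v f h : V) (s t : term) (w : 'X_{1..n}) (a b : R).

(** * Consequences of the ordering axioms *)

Lemma lt_irr : irreflexive lt. Proof. by case: lt_ord => -[]. Qed.
Lemma lt_tr : transitive lt. Proof. by case: lt_ord => -[]. Qed.
Lemma lt_total s t : s != t -> lt s t || lt t s.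
Proof. by case: lt_ord => -[_ _ + _] _ _; apply. Qed.

Lemma smulD w1 w2 t : smul (w1 + w2)%MM t = smul w1 (smul w2 t).
Proof. by rewrite /smul /= addmA. Qed.

(* Otherwise 1 > Y_i > Y_i^2 > ... would be an infinite descent. *)
Lemma lt_smulU i t : lt t (smul U_(i)%MM t).
Proof.
case: prec_ord => -[_ _ tot wf] mon.
have nlt x : prec (U_(i) + x)%MM x -> False.
  by elim/(well_founded_ind wf): x => x IH lt_x; apply: (IH _ lt_x); apply: mon.
have: prec 0%MM U_(i)%MM || prec U_(i)%MM 0%MM.
  by apply: tot; rewrite eq_sym mnm1_eq0.
case/orP=> [lt0|lt0]; last by case: (nlt 0%MM); rewrite addm0.
case: lt_ord => _ /(_ _ _ t lt0) + _.
by rewrite /smul add0m; case: t.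
Qed.

Lemma term_le_trans : transitive (term_le lt).
Proof.
move=> t s r /predU1P[->//|st] /predU1P[<-|tr]; rewrite /term_le ?st ?orbT //.
by rewrite (lt_tr st tr) orbT.
Qed.

Lemma term_le_smul w s t : term_le lt s t -> term_le lt (smul w s) (smul w t).
Proof.
case/predU1P=> [->|st]; rewrite /term_le ?eqxx //.
by case: lt_ord => _ _ /(_ w _ _ st) ->; rewrite orbT.
Qed.

(** * Coefficients and leading terms in the free module *)

Definition vcoef (v : V) (t : term) : R := (v 0 t.2 : {mpoly R[n]})@_t.1.

(** An upper bound on the support makes sense for the zero vector too; with a nonzero coefficient at
    [t] it characterises [lterm]. *)
Definition vbounded (v : V) (t : term) : Prop :=
  forall s, vcoef v s != 0 -> term_le lt s t.

Lemma mem_vsupp v t : (t \in vsupp v) = (vcoef v t != 0).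
Proof.
apply/allpairsPdep/idP => [[i [w [_ + ->]]]|nz]; first by rewrite mcoeff_msupp.
by exists t.2, t.1; rewrite mem_enum mcoeff_msupp; case: t nz.
Qed.

Lemma vcoef_neq0 v : v != 0 -> exists t, vcoef v t != 0.
Proof.
move=> v0; have [i vi] : exists i, v 0 i != 0.
  apply/existsP; apply: contraNT v0; rewrite negb_exists => /forallP v0.
  by apply/eqP/rowP=> i; rewrite mxE; apply/eqP; rewrite -[_ == _]negbK v0.
(* Any term of the support would do; the monomial order behind [mlead] is unrelated to [lt]. *)
exists (mlead (v 0 i : {mpoly R[n]}), i).
by rewrite /vcoef -[_@__]/(mleadc (v 0 i : {mpoly R[n]})) mleadc_eq0.
Qed.

Lemma lterm_max v t : vcoef v t != 0 ->
  vcoef v (lterm lt v) != 0 /\ vbounded v (lterm lt v).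
Proof.
rewrite -mem_vsupp => /(max_of_mem (0%MM, ord0) lt_tr lt_total).
by rewrite mem_vsupp => -[? max_v]; split=> // s; rewrite -mem_vsupp => /max_v.
Qed.

Lemma lterm_eq v t : vcoef v t != 0 -> vbounded v t -> lterm lt v = t.
Proof.
move=> vt bnd; have [/bnd/predU1P[//|lt1] /(_ _ vt)/predU1P[//|lt2]] := lterm_max vt.
by have := lt_tr lt1 lt2; rewrite lt_irr.
Qed.

Lemma lcoef_neq0 v : v != 0 -> lcoef lt v != 0.
Proof. by case/vcoef_neq0 => t /lterm_max[]. Qed.

Lemma vbounded_lterm v : vbounded v (lterm lt v).
Proof. by move=> s vs; case: (lterm_max vs) => _; apply. Qed.

Lemma vcoefZ a w v t :
  vcoef (ore_monomial D a w *: v) t = a * (tstar D w (v 0 t.2))@_t.1.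
Proof.
rewrite /vcoef mxE.
change ((ore_mul D (a *: 'X_[w]) (v 0 t.2))@_t.1 = a * (tstar D w (v 0 t.2))@_t.1).
by rewrite ore_mulZl ore_mulX mcoeffZ.
Qed.

Lemma vcoef_sum (I : Type) (r : seq I) (P : pred I) (F : I -> V) t :
  vcoef (\sum_(i <- r | P i) F i) t = \sum_(i <- r | P i) vcoef (F i) t.
Proof.
apply: (big_morph (vcoef^~ t)) => [v1 v2|]; rewrite /vcoef mxE; last exact: mcoeff0.
exact: mcoeffD.
Qed.

(** Induction adding one variable at a time: the [delta] part stays below the old bound, hence
    strictly below the new one, so only the [alpha] part reaches the top. *)
Lemma tstar_lead v t w : vbounded v t ->
  (forall s, (tstar D w (v 0 s.2))@_s.1 != 0 -> term_le lt s (smul w t)) /\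
  (tstar D w (v 0 t.2))@_(w + t.1)%MM = alpha_term D w (vcoef v t).
Proof.
move=> bnd; elim/mnm_ind: w => [|i w [IHbnd IHlc]].
  split=> [s|]; rewrite tstarX0 /smul add0m ?alpha_term0 //.
  by move/bnd; case: t {bnd}.
split=> [[s j] /=|]; rewrite tstar_ystar -?addmA.
  case/ystar_supp => [nz|[r -> nz]]; rewrite smulD.
    apply: term_le_trans (IHbnd (s, j) nz) _.
    by rewrite /term_le lt_smulU orbT.
  exact: term_le_smul (IHbnd (r, j) nz).
rewrite ystar_coef IHlc alpha_termD alpha_termU.
(* The [delta] contribution comes from a coefficient beyond the bound [smul w t]. *)
suff -> : (tstar D w (v 0 t.2))@_(U_(i) + (w + t.1))%MM = 0 by rewrite raddf0 addr0.
apply/eqP; apply: contraT => /(IHbnd (smul U_(i)%MM (smul w t))).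
have lt1 := lt_smulU i (smul w t).
by case/predU1P=> [eqt|/(lt_tr lt1)]; [move: lt1; rewrite eqt|]; rewrite lt_irr.
Qed.

(** * Monomials and the graded action *)

Lemma vcoef_vmonomial a t : vcoef (vmonomial D a t) t = a.
Proof.
by rewrite /vcoef mxE eqxx /ore_monomial mcoeffZ mcoeffX eqxx mulr1.
Qed.

Lemma vcoef_vmonomial_neq a s t : s != t -> vcoef (vmonomial D a t) s = 0.
Proof.
case: s t => s i [t j]; rewrite xpair_eqE negb_and orbC => st.
rewrite /vcoef mxE /=; case: eqP st => [_|_] /= st; last exact: mcoeff0.
by rewrite /ore_monomial mcoeffZ mcoeffX eq_sym (negPf st) mulr0.
Qed.

Lemma vcoef_inj v1 v2 : (forall t, vcoef v1 t = vcoef v2 t) -> v1 = v2.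
Proof. by move=> eqv; apply/rowP=> i; apply/mpolyP=> w; apply: (eqv (w, i)). Qed.

Lemma vmonomial_sum (I : Type) (r : seq I) (P : pred I) (F : I -> R) t :
  \sum_(i <- r | P i) vmonomial D (F i) t =
  vmonomial D (\sum_(i <- r | P i) F i) t.
Proof.
apply: vcoef_inj => s; rewrite vcoef_sum.
have [->|st] := eqVneq s t.
  by rewrite vcoef_vmonomial; apply: eq_bigr => i _; rewrite vcoef_vmonomial.
by rewrite vcoef_vmonomial_neq // big1 // => i _; rewrite vcoef_vmonomial_neq.
Qed.

Lemma msupp_monomial a w : a != 0 -> msupp (a *: 'X_[w] : {mpoly R[n]}) = [:: w].
Proof.
move=> a0; apply/perm_small_eq/uniq_perm => // t.
rewrite inE mcoeff_msupp mcoeffZ mcoeffX [t == w]eq_sym.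
by case: (w == t); rewrite ?mulr1 ?mulr0 ?eqxx ?a0.
Qed.

(** For [a = 0] the support is empty; the hypothesis lets one formula cover this case. *)
Lemma sum_msupp_monomial a w (F : 'X_{1..n} -> {mpoly R[n]}) :
  (a = 0 -> F w = 0) ->
  \sum_(t <- msupp (a *: 'X_[w] : {mpoly R[n]})) F t = F w.
Proof.
have [->|a0 _] := eqVneq a 0; last by rewrite msupp_monomial // big_seq1.
by move=> ->; rewrite ?scale0r ?msupp0 ?big_nil.
Qed.

Lemma gr_act_monomial a w b t :
  gr_act (ore_monomial D a w) (vmonomial D b t) =
  vmonomial D (a * alpha_term D w b) (smul w t).
Proof.
have cX c (s : 'X_{1..n}) : (c *: 'X_[s] : {mpoly R[n]})@_s = c.
  by rewrite mcoeffZ mcoeffX eqxx mulr1.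
apply/rowP=> i; rewrite !mxE /=; case: eqP => _; last first.
  by rewrite /gr_mul msupp0 big1 // => s _; rewrite big_nil.
rewrite /gr_mul /ore_monomial sum_msupp_monomial ?cX => [|->]; last first.
  by rewrite big1 // => s _; rewrite mul0r scale0r.
rewrite sum_msupp_monomial ?cX // => ->.
by rewrite (alpha_term_additive w).2 mulr0 scale0r.
Qed.

(** * Completion elements and the two implications *)

Section Basis.
Context (u : nat) (g : 'I_u -> V).
Context (g_neq0 : forall i, g i != 0).

Local Notation "'tau_ i" := (lterm lt (g i)).1 (at level 8, i at level 2).

Lemma lcm_term_le (H : {set 'I_u}) w :
  reflect (forall i, i \in H -> ('tau_ i <= w)%MM) (lcm_term lt g H <= w)%MM.
Proof.
rewrite /lcm_term (big_morph (fun x => (x <= w)%MM) (lem_mlcm w) (id1 := true)).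
  by rewrite big_andE; apply: forall_inP.
by apply/mnm_lepP => i; rewrite mnm0E.
Qed.

Lemma le_lcm_term (H : {set 'I_u}) i : i \in H -> ('tau_ i <= lcm_term lt g H)%MM.
Proof. by apply/lcm_term_le/lepm_refl. Qed.

Lemma completion_element_exists H e :
  left_principal_ideal_ring R -> maximal_set lt g H e ->
  exists f, completion_element prec lt g H e f.
Proof.
move=> pid [/set0Pn[i0 i0H] He _].
pose x i := alpha_set lt g H i (lcoef lt (g i)).
have [|d d_gcd] := pid (fun y => exists b : 'I_u -> R, y = \sum_(i in H) b i * x i).
  split=> [|y z [b ->] [c ->]|a y [b ->]].
  - by exists (fun=> 0); rewrite big1 // => i _; rewrite mul0r.
  - exists (fun i => b i + c i); rewrite -big_split.
    by apply: eq_bigr => i _; rewrite mulrDl.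
  - exists (fun i => a * b i); rewrite mulr_sumr.
    by apply: eq_bigr => i _; rewrite mulrA.
have [b d_sum] : exists b : 'I_u -> R, d = \sum_(i in H) b i * x i.
  by apply/d_gcd; exists 1; rewrite mul1r.
(* [x i0] is a nonzero multiple of [d], because the [alpha] maps are injective. *)
have d_neq0 : d != 0.
  have [a] : exists a, x i0 = a * d.
    apply/d_gcd; exists (fun i => (i == i0)%:R).
    rewrite (bigD1 i0) //= eqxx mul1r big1 ?addr0 // => i /andP[_ /negPf->].
    by rewrite mul0r.
  apply: contra_eq_neq => ->.
  by rewrite mulr0 /x /alpha_set alpha_term_eq0 lcoef_neq0.
pose w i := (lcm_term lt g H - 'tau_ i)%MM.
pose T : term := (lcm_term lt g H, e).
have wT i : i \in H -> smul (w i) (lterm lt (g i)) = T.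
  by move=> iH; rewrite /smul (He i iH) submK ?le_lcm_term.
(* Each summand with index in [H] is bounded by [T], and the coefficients at [T] add up to [d],
   which is nonzero: the top does not cancel. *)
pose l i : S := if i \in H then ore_monomial D (b i) (w i) else 0.
pose f := \sum_i l i *: g i.
have fE t : vcoef f t = \sum_(i in H) b i * (tstar D (w i) (g i 0 t.2))@_t.1.
  rewrite /f (bigID (mem H)) /= [X in _ + X]big1 ?addr0 => [|i iH].
    by rewrite vcoef_sum; apply: eq_bigr => i iH; rewrite /l iH vcoefZ.
  by rewrite /l (negPf iH) scale0r.
have fT : vcoef f T = d.
  rewrite fE d_sum; apply: eq_bigr => i iH; congr (_ * _).
  have [_] := tstar_lead (w i) (@vbounded_lterm (g i)).
  by rewrite -[(_ + _)%MM]/(smul (w i) (lterm lt (g i))).1 wT // (He i iH).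
have f_bnd : vbounded f T.
  move=> s; apply: contraR => /negP sT; rewrite fE big1 // => i iH.
  apply/eqP; apply: contraT => nz; case: sT; rewrite -(wT i iH).
  have [bnd _] := tstar_lead (w i) (@vbounded_lterm (g i)).
  by apply: bnd; apply: contraNneq nz => ->; rewrite mulr0.
have f_lt : lterm lt f = T by apply: lterm_eq; rewrite ?fT.
have f_lc : lcoef lt f = d by rewrite -fT -f_lt.
exists f; split=> //; first by exists l.
  by rewrite f_lc => y; split=> /d_gcd.
split.
  apply: contraNneq d_neq0 => f0; rewrite -fT f0 /vcoef mxE.
  by rewrite mcoeff0.
exists l; split=> // i; rewrite f_lt /l; case: ifPn => [iH|]; last by rewrite eqxx.
rewrite /ore_monomial => nz.
suff -> : ore_lterm prec (b i *: 'X_[w i] : {mpoly R[n]}) = w i.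
  by rewrite wT // /term_le eqxx.
have b0 : b i != 0 by apply: contraNneq nz => ->; rewrite scale0r.
by rewrite /ore_lterm msupp_monomial.
Qed.

Lemma weak_strong (C : V -> Prop) : weak_groebner_basis lt g ->
  completion prec lt g C -> strong_groebner_basis lt (left_span g) C.
Proof.
move=> weak [C_ex C_only]; split=> [f /C_only[H [e [_ []]]]//|f Mf f0].
have [k [a [w [j [wT Mf_sum]]]]] := weak f Mf f0.
have lc_neq0 := lcoef_neq0 f0.
have lcE : lcoef lt f = \sum_i a i * alpha_term D (w i) (lcoef lt (g (j i))).
  rewrite -[LHS](vcoef_vmonomial _ (lterm lt f)) -/(lmonomial lt f) Mf_sum.
  rewrite -[RHS](vcoef_vmonomial _ (lterm lt f)) -vmonomial_sum; congr vcoef.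
  by apply: eq_bigr => i _; rewrite gr_act_monomial (wT i).2.
(* An empty sum would give a zero leading coefficient. *)
have i0 : 'I_k.
  case: k a w j {Mf_sum wT} lcE => [|k *]; last exact: ord0.
  by move=> a w j lcE; move: lc_neq0; rewrite lcE big_ord0 eqxx.
pose T := lterm lt f.
pose H := [set i | ('tau_ i <= T.1)%MM && ((lterm lt (g i)).2 == T.2)].
have jH i : j i \in H.
  by rewrite inE /T -(wT i).2 /smul /= eqxx lem_addl.
have lcmH : (lcm_term lt g H <= T.1)%MM.
  by apply/lcm_term_le => i; rewrite inE => /andP[].
have maxH : maximal_set lt g H T.2.
  split; first by apply/set0Pn; exists (j i0).
    by move=> i; rewrite inE => /andP[_ /eqP].
  apply/setP=> i; rewrite [in RHS]inE; apply/idP/andP=> [iH|[le_i e_i]].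
    by rewrite le_lcm_term //; move: iH; rewrite inE => /andP[].
  by rewrite inE e_i (lepm_trans le_i lcmH).
have [h Ch [_ h_lt h_gcd _]] := C_ex _ _ maxH.
pose v := (T.1 - lcm_term lt g H)%MM.
(* Left multiples are closed under sums, so each summand is treated alone. Applying [alpha_term D v]
   to the divisibility by the gcd suffices, as [w i] is [v] plus the cofactor of [g (j i)] in the
   lcm. *)
have [A lcA] : exists A, lcoef lt f = A * alpha_term D v (lcoef lt h).
  rewrite lcE; elim/big_ind: _ => [|y z [A ->] [B ->]|i _].
  - by exists 0; rewrite mul0r.
  - by exists (A + B); rewrite mulrDl.
  have [x xE] : exists x, alpha_set lt g H (j i) (lcoef lt (g (j i))) = x * lcoef lt h.
    apply/h_gcd; exists (fun i' => (i' == j i)%:R).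
    rewrite (bigD1 (j i)) //= eqxx mul1r big1 ?addr0 // => i' /andP[_ /negPf->].
    by rewrite mul0r.
  exists (a i * alpha_term D v x); rewrite -mulrA -alpha_termM -xE -alpha_termD.
  congr (_ * alpha_term _ _ _).
  by rewrite addmBA ?le_lcm_term // submK // /T -(wT i).2 /= addmK.
exists h, A, v; split=> //.
  by apply: contraNneq lc_neq0 => A0; rewrite lcA A0 mul0r.
by rewrite gr_act_monomial -lcA h_lt /smul submK // /T; case: (lterm lt f).
Qed.

Lemma strong_weak (C : V -> Prop) : completion prec lt g C ->
  strong_groebner_basis lt (left_span g) C -> weak_groebner_basis lt g.
Proof.
move=> [_ C_only] [_ strong] f Mf f0; have lc_neq0 := lcoef_neq0 f0.
have [h [a [w [Ch _]]]] := strong f Mf f0; rewrite gr_act_monomial => Mf_eq.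
have [H [e [[_ He _] [_ h_lt h_gcd _]]]] := C_only h Ch.
(* Monomials on distinct terms could agree only if [lcoef lt f] vanished. *)
have f_lt : lterm lt f = smul w (lterm lt h).
  apply/eqP; apply: contraNT lc_neq0 => neq.
  by rewrite -(vcoef_vmonomial (lcoef lt f) (lterm lt f)) -/(lmonomial lt f) Mf_eq
    vcoef_vmonomial_neq.
have f_lc : lcoef lt f = a * alpha_term D w (lcoef lt h).
  by rewrite -[LHS](vcoef_vmonomial _ (lterm lt f)) -/(lmonomial lt f) Mf_eq
    f_lt vcoef_vmonomial.
have [b hE] : exists b : 'I_u -> R,
    lcoef lt h = \sum_(i in H) b i * alpha_set lt g H i (lcoef lt (g i)).
  by apply/h_gcd; exists 1; rewrite mul1r.
pose A i := a * alpha_term D w (b i).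
pose W i := (w + (lcm_term lt g H - 'tau_ i))%MM.
(* A weak basis demands nonzero coefficients, so vanishing ones are discarded; [enum_val] then
   indexes the rest by an ordinal. *)
pose K := [set i in H | A i != 0].
have WT i : i \in H -> smul (W i) (lterm lt (g i)) = lterm lt f.
  by move=> iH; rewrite f_lt h_lt /smul /= (He i iH) -addmA submK // le_lcm_term.
exists #|K|, (A \o enum_val), (W \o enum_val), enum_val; split=> [i|].
  have := enum_valP i; rewrite inE => /andP[iH Ai].
  by split=> //=; rewrite WT.
rewrite -(big_enum_val (A := mem K) (fun i => gr_act (ore_monomial D (A i) (W i))
  (lmonomial lt (g i)))) /=.
transitivity (\sum_(i in K)
  vmonomial D (A i * alpha_term D (W i) (lcoef lt (g i))) (lterm lt f)); last first.
  apply: eq_bigr => i; rewrite inE => /andP[iH _].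
  by rewrite gr_act_monomial WT.
rewrite vmonomial_sum; congr vmonomial.
rewrite f_lc hE alpha_term_sum mulr_sumr (bigID (fun i => A i != 0)) /=.
rewrite [X in _ + X]big1 ?addr0 => [|i /andP[_]].
  apply: eq_big => [i|i _]; first by rewrite inE.
  by rewrite alpha_termM mulrA /alpha_set -alpha_termD.
by rewrite /A negbK alpha_termM mulrA => /eqP->; rewrite mul0r.
Qed.

(** Taking all completion elements at once avoids choosing one for each [H]. *)
Lemma completion_exists : left_principal_ideal_ring R ->
  exists C, completion prec lt g C.
Proof.
move=> pid.
exists (fun f => exists H e, maximal_set lt g H e /\ completion_element prec lt g H e f).
split=> // H e maxH; have [f fH] := completion_element_exists pid maxH.
by exists f => //; exists H, e.
Qed.

End Basis.
End Groebner.

Theorem proposition56 (R : nzRingType)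
  (R_zacharias : left_zacharias R)
  (R_domain : is_domain R)
  (R_pid : left_principal_ideal_ring R)
  (n : nat) (D : oreData R n)
  (alpha_aut : forall i : 'I_n, bijective (ore_alpha D i))
  (m : nat) (prec : rel 'X_{1..n}) (lt : rel (vterm n m.+1))
  (prec_ord : term_ordering prec)
  (lt_ord : compatible_term_ordering prec lt)
  (u : nat) (g : 'I_u -> 'rV[oreExt D]_m.+1)
  (g_neq0 : forall i, g i != 0) :
  (weak_groebner_basis lt g <->
     exists C : 'rV[oreExt D]_m.+1 -> Prop,
       completion prec lt g C /\ strong_groebner_basis lt (left_span g) C)
  /\
  (weak_groebner_basis lt g <->
     forall C : 'rV[oreExt D]_m.+1 -> Prop,
       completion prec lt g C -> strong_groebner_basis lt (left_span g) C).
Proof.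
(* Existence supplies the witness for the first equivalence and keeps the universal condition in the
   second from being vacuous. *)
have [C C_compl] := completion_exists prec_ord lt_ord g_neq0 R_pid.
split; split=> [weak|].
- by exists C; split=> //; apply: weak_strong weak C_compl.
- by case=> C' [compl strong]; apply: strong_weak compl strong.
- by move=> C' compl; apply: weak_strong weak compl.
- by move=> strong; apply: strong_weak C_compl (strong C C_compl).
Qed.
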